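(* The 9-element sets $\{0,1,2,3,4,5,6,7,8\}$ and $\{0,1,2,4,5,6,8,9,10\}$ are extreme in $\mathbb Z_{12}$. They are non-equivalent.
   Context: $\mathbb Z_n$ denotes the cyclic group of order $n$. For a finite abelian group $G$ with dual group $\Gamma$ and a complex measure $\mu$ on $G$: $\|\mu\|=\sum_{x\in G}|\mu(\{x\})|$, $\widehat\mu(\gamma)=\sum_{x\in G}\overline{\gamma(x)}\,\mu(\{x\})$ for $\gamma\in\Gamma$, and $\|\widehat\mu\|_\infty=\max_\gamma|\widehat\mu(\gamma)|$. A non-zero measure $\mu$ on $G$ is extreme if $\|\widehat\mu\|_\infty=\|\mu\|/\sqrt{\#\mathrm{supp}\,\mu}$. A set $E\subset G$ is extreme if it is the support of an extreme measure on $G$. Two subsets of $G$ are equivalent if one can be obtained from the other by a sequence of group automorphisms of $G$ and translations. *)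

(* Defs.v *)
From mathcomp Require Import all_boot all_order all_algebra all_fingroup.
From mathcomp Require Import complex.
From mathcomp Require Import boolp classical_sets reals.

Set Implicit Arguments.
Unset Strict Implicit.
Unset Printing Implicit Defensive.

Import Order.TTheory GRing.Theory Num.Theory.

Local Open Scope ring_scope.

(* A complex measure on the finite group G is represented by its point masses,
   x |-> mu({x}). *)
Definition cmeasure (R : realType) (G : finZmodType) := {ffun G -> R[i]}.

Section ExtremeMeasures.
Variables (R : realType) (G : finZmodType).
Implicit Type mu : cmeasure R G.

Definition is_character (gamma : G -> R[i]) : Prop :=
  (forall x, Normc.normc (gamma x) = 1) /\
  (forall x y, gamma (x + y) = gamma x * gamma y).

Definition dual_group : set (G -> R[i]) := [set gamma | is_character gamma]%classic.

Definition msupp mu : {set G} := [set x | mu x != 0].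

Definition mnorm mu : R := \sum_(x : G) Normc.normc (mu x).

Definition fourier mu (gamma : G -> R[i]) : R[i] :=
  \sum_(x : G) (gamma x)^*%C * mu x.

(* The dual group is finite and nonempty, so this supremum is a maximum. *)
Definition fourier_norm mu : R :=
  sup [set Normc.normc (fourier mu gamma) | gamma in dual_group]%classic.

Definition extreme_measure mu : Prop :=
  mu != 0 /\ fourier_norm mu = mnorm mu / Num.sqrt #|msupp mu|%:R.

Definition extreme_set (E : {set G}) : Prop :=
  exists mu, extreme_measure mu /\ msupp mu = E.

End ExtremeMeasures.

Section Equivalence.
Variable G : finZmodType.

Definition automorphic_image (E F : {set G}) : bool :=
  [exists s in Aut [set: G], F == [set s x | x in E]].

Definition translate (E F : {set G}) : bool :=
  [exists a : G, F == [set x + a | x in E]].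

Definition equivalent : rel {set G} :=
  connect (fun E F => automorphic_image E F || translate E F).

End Equivalence.
Arguments extreme_set R {G} E.

(* Main.v *)
Require Import Defs.
From mathcomp Require Import all_boot all_order all_algebra all_fingroup.
From mathcomp Require Import complex.
From mathcomp Require Import reals.
From mathcomp Require Import ring.

Set Implicit Arguments.
Unset Strict Implicit.
Unset Printing Implicit Defensive.

Import Order.TTheory GRing.Theory Num.Theory.

Local Open Scope ring_scope.

(** By Parseval, the mean of |mu^|^2 over the dual group is the sum of the
    |mu(x)|^2, and by Cauchy-Schwarz this is at least ||mu||^2 / #supp mu.  So
    an extreme measure is one for which both averages are attained: |mu| is
    constant on its support and |mu^| is constant on the dual group.  The
    second condition says that the Fourier transform of the autocorrelation
    h |-> sum_x mu(x + h) conj(mu(x)) is constant, that is, that this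
    autocorrelation vanishes for h != 0.  To show that a set is extreme it is
    therefore enough to exhibit unimodular phases on it with vanishing periodic
    autocorrelation ([flat_autocorrelation_extreme]).

    Both sets admit such phases among the 24th roots of unity, so that the
    autocorrelations are integer combinations of powers of a primitive 24th
    root z, and each of them is zero modulo the cyclotomic polynomial
    z^8 - z^4 + 1.  Identifying Z_12 with Z_3 x Z_4, the set
    F = {0,1,2,4,5,6,8,9,10} is Z_3 x {0,1,2}; the phases are the product of
    (1, 1, w) on Z_3, where w is a cube root of unity, and of (1, c, -c^2) on
    {0,1,2} in Z_4, where c is a primitive 8th root of unity.  The interval
    E = {0,...,8} is not a product of this kind, and its phases [phasesE] are a
    solution of the autocorrelation equations without such a factorization.

    The sets are told apart by periods: F + 4 = F, and having a nonzero period
    is invariant under automorphisms and translations, whereas no nonzero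
    translation preserves E. *)

(** * Unimodular functions with vanishing autocorrelation *)

Section FlatSpectrum.
Variable R : realType.

Lemma normc_sqr (c : R[i]) : ((Normc.normc c) ^+ 2)%:C%C = c * c^*%C.
Proof. by rewrite -sqr_normc rmorphXn /= normc_def; case: c. Qed.

Lemma normc_ge0 (c : R[i]) : 0 <= Normc.normc c.
Proof. by case: c => a b; rewrite sqrtr_ge0. Qed.

Lemma normcX (c : R[i]) n : Normc.normc (c ^+ n) = Normc.normc c ^+ n.
Proof.
by elim: n => [|n IHn]; rewrite ?Normc.normc1 // !exprS Normc.normcM IHn.
Qed.

Lemma unimodular_mul_conjc (c : R[i]) : Normc.normc c = 1 -> c * c^*%C = 1.
Proof. by move=> c1; rewrite -normc_sqr c1 expr1n. Qed.

Variable G : finZmodType.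
Implicit Type mu : cmeasure R G.

Lemma is_character1 : is_character (fun _ : G => 1 : R[i]).
Proof. by split=> [x|x y]; rewrite ?Normc.normc1 ?mulr1. Qed.

Lemma character_mulV (gamma : G -> R[i]) x y : is_character gamma ->
  (gamma (x + y))^*%C * gamma x = (gamma y)^*%C.
Proof.
move=> [g1 gD]; rewrite gD rmorphM /= mulrAC [_ * gamma x]mulrC.
by rewrite unimodular_mul_conjc ?mul1r.
Qed.

Definition autocorrelation mu (h : G) : R[i] :=
  \sum_(x : G) mu (x + h) * (mu x)^*%C.

(** The Wiener-Khinchin identity: expanding |mu^(gamma)|^2 as a double sum
    over (x, y) and substituting y = x + h leaves only gamma(h), since gamma is
    multiplicative and unimodular. *)
Lemma fourier_sqr mu (gamma : G -> R[i]) : is_character gamma ->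
  ((Normc.normc (fourier mu gamma)) ^+ 2)%:C%C =
  \sum_(h : G) (gamma h)^*%C * autocorrelation mu h.
Proof.
move=> gP; rewrite normc_sqr /fourier rmorph_sum /= mulrC mulr_suml.
under [RHS]eq_bigr do rewrite mulr_sumr.
rewrite [RHS]exchange_big /=; apply: eq_bigr => x _.
rewrite mulr_sumr (reindex_inj (addrI x)) /=; apply: eq_bigr => h _.
rewrite -(character_mulV x h gP) !rmorphM /= conjcK; ring.
Qed.

Lemma fourier_norm_flat mu (c : R) :
  (forall gamma, is_character gamma -> Normc.normc (fourier mu gamma) = c) ->
  fourier_norm mu = c.
Proof.
move=> flat; rewrite -[RHS]sup1 /fourier_norm; congr sup.
apply/classical_sets.seteqP; split=> [_ [gamma gP <-]|_ ->] /=.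
  exact: flat.
by exists (fun=> 1); [exact: is_character1 | exact/flat/is_character1].
Qed.

(** Only the term h = 0 of the autocorrelation survives, and it counts the
    points of E; hence |mu^| = sqrt #E everywhere, while ||mu|| = #E. *)
Lemma flat_autocorrelation_extreme mu (E : {set G}) :
  E != set0 -> msupp mu = E ->
  {in E, forall x, Normc.normc (mu x) = 1} ->
  (forall h, h != 0 -> autocorrelation mu h = 0) ->
  extreme_set R E.
Proof.
move=> E0 suppE mu1 corr0; exists mu; split=> //.
have muP x : x \notin E -> mu x = 0.
  by rewrite -suppE inE negbK => /eqP.
have cardE_gt0 : (0 < #|E|)%N by rewrite card_gt0.
have normE : mnorm mu = #|E|%:R.
  rewrite /mnorm (bigID (mem E)) /= [X in _ + X]big1 ?addr0 => [|x /muP->].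
    by rewrite (eq_bigr (fun=> 1)) ?sumr_const.
  exact: Normc.normc0.
have corr_at0 : autocorrelation mu 0 = #|E|%:R.
  rewrite /autocorrelation (bigID (mem E)) /= [X in _ + X]big1 ?addr0.
    rewrite (eq_bigr (fun=> 1)) ?sumr_const // => x xE.
    by rewrite addr0 unimodular_mul_conjc ?mu1.
  by move=> x /muP muz; rewrite addr0 muz mul0r.
have flat gamma : is_character gamma ->
    Normc.normc (fourier mu gamma) = Num.sqrt #|E|%:R.
  move=> gP; rewrite -[LHS]ger0_norm ?normc_ge0 // -sqrtr_sqr.
  congr Num.sqrt; apply: complexI; rewrite fourier_sqr // (bigD1 0) //=.
  rewrite big1 ?addr0 => [|h /corr0->]; last exact: mulr0.
  have g0 : (gamma 0)^*%C = 1.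
    have [_ <-] := (is_character1, character_mulV 0 0 gP).
    rewrite addr0 mulrC unimodular_mul_conjc //; exact: gP.1.
  by rewrite corr_at0 g0 mul1r rmorph_nat.
split.
  apply: contraNneq E0 => mu0; rewrite -suppE mu0.
  by apply/eqP/setP=> x; rewrite !inE ffunE eqxx.
rewrite suppE normE (fourier_norm_flat flat) -{2}[#|E|%:R]sqr_sqrtr ?ler0n //.
by rewrite expr2 mulfK // gt_eqF // sqrtr_gt0 ltr0n.
Qed.

End FlatSpectrum.

(** * Measures on Z_12 with values in the 24th roots of unity *)

Section RootMeasures.
Variable R : realType.

(** The equation is that of the 24th cyclotomic polynomial.  In this form it is a
    rewriting rule that reduces every power of z to the basis 1, ..., z^7 of
    Z[z], so that a combination of powers of z that vanishes does so by ring
    normalization. *)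
Lemma exists_root24 : exists z : R[i], z ^+ 8 = z ^+ 4 - 1.
Proof.
have /closed_rootP[z]: size ('X^8 - 'X^4 + 1 : {poly R[i]}) != 1%N.
  rewrite -addrA size_polyDl ?size_polyXn //.
  rewrite (leq_ltn_trans (size_polyD _ _)) //.
  by rewrite size_polyN size_polyXn size_polyC oner_eq0.
rewrite /root !hornerE => /eqP zP; exists z.
by rewrite -[LHS]subr0 -zP; ring.
Qed.

Variable z : R[i].
Hypothesis zE : z ^+ 8 = z ^+ 4 - 1.

Lemma root24_expr24 : z ^+ 24 = 1.
Proof. by ring: zE. Qed.

Lemma root24_normc : Normc.normc z = 1.
Proof.
have n24 : Normc.normc z ^+ 24 = 1.
  by rewrite -normcX root24_expr24 Normc.normc1.
by apply/eqP; rewrite -(pexpr_eq1 (n := 24)) ?normc_ge0 ?n24.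
Qed.

Lemma root24_conjc : z^*%C = z ^+ 23.
Proof.
have zn0 : z != 0.
  by apply: contra_eq_neq root24_expr24 => ->; rewrite expr0n eq_sym oner_eq0.
by apply: (mulfI zn0); rewrite unimodular_mul_conjc ?root24_normc // -exprS root24_expr24.
Qed.

(** A measure on Z_12 with values in {0} and the powers of z is encoded by the
    list of the exponents at 0, ..., 11, with None for a point without mass.
    This keeps the autocorrelations computable: only the exponents are
    manipulated, in [correlation_phases]. *)
Definition phase (e : option nat) : R[i] := if e is Some k then z ^+ k else 0.

Definition root_measure (t : seq (option nat)) : cmeasure R 'Z_12 :=
  [ffun x : 'Z_12 => phase (nth None t x)].

(** The exponent of z^k conj(z^l), using conj z = z^23 to avoid subtraction. *)
Definition phase_quotient (e f : option nat) : option nat :=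
  if e is Some k then if f is Some l then Some ((k + 23 * l) %% 24)%N else None
  else None.

Lemma phase_quotientE e f : phase (phase_quotient e f) = phase e * (phase f)^*%C.
Proof.
case: e f => [k|] [l|]; rewrite ?mul0r // /phase /phase_quotient.
  by rewrite expr_mod ?root24_expr24 // exprD exprM -root24_conjc rmorphXn.
by rewrite rmorph0 mulr0.
Qed.

Definition correlation_phases (t : seq (option nat)) (h : nat) :=
  [seq phase_quotient (nth None t ((x + h) %% 12)) (nth None t x) | x <- iota 0 12].

Lemma root_autocorrelation t (h : 'Z_12) :
  autocorrelation (root_measure t) h = \sum_(e <- correlation_phases t h) phase e.
Proof.
rewrite big_map -[iota 0 12]/(index_iota 0 12) big_mkord.
by apply: eq_bigr => x _; rewrite !ffunE phase_quotientE.
Qed.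

Lemma root_measure_extreme t (E : {set 'Z_12}) :
  E != set0 -> (forall x, (x \in E) = (nth None t x : bool)) ->
  (forall h, (0 < h < 12)%N -> \sum_(e <- correlation_phases t h) phase e = 0) ->
  extreme_set R E.
Proof.
move=> En0 memE corr0.
have norm1 x : x \in E -> Normc.normc (root_measure t x) = 1.
  rewrite memE ffunE; case: (nth _ _ _) => //= k _.
  by rewrite normcX root24_normc expr1n.
apply: (flat_autocorrelation_extreme En0 _ norm1).
  apply/setP => x; rewrite inE; apply/idP/idP => [|xE].
    by rewrite memE ffunE; case: (nth _ _ _); rewrite //= eqxx.
  by apply: contra_eq_neq (norm1 x xE) => ->; rewrite Normc.normc0 eq_sym oner_eq0.
by move=> h hn0; rewrite root_autocorrelation corr0 // lt0n hn0 /=.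
Qed.

End RootMeasures.

(** * The phases for the two sets *)

(** At every shift these exponents make the autocorrelation a sum of 24th roots
    of unity that splits into pairs z^k, z^(k+12) and triples
    z^k, z^(k+8), z^(k+16), each of sum zero: at shift 2, for
    instance, the exponents are 10, 22 and 6, 18 and 6, 14, 22. *)
Definition phasesE :=
  [seq Some k | k <- [:: 0; 1; 22; 23; 8; 13; 2; 19; 8]]%N ++ nseq 3 None.

(** The product, through x |-> (x mod 3, x mod 4), of the phases (1, 1, z^8) on
    Z_3 and (1, z^3, z^18) on {0, 1, 2} in Z_4. *)
Definition phasesF :=
  [seq if (x %% 4 < 3)%N
       then Some (nth 0 [:: 0; 0; 8] (x %% 3) + nth 0 [:: 0; 3; 18] (x %% 4))%N
       else None | x <- iota 0 12].

Lemma correlations_phasesE (R : realType) (z : R[i]) : z ^+ 8 = z ^+ 4 - 1 ->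
  forall h, (0 < h < 12)%N -> \sum_(e <- correlation_phases phasesE h) phase z e = 0.
Proof.
move=> zE h; do 12?[case: h => [|h]] => // _;
  rewrite unlock /=; ring: zE.
Qed.

Lemma correlations_phasesF (R : realType) (z : R[i]) : z ^+ 8 = z ^+ 4 - 1 ->
  forall h, (0 < h < 12)%N -> \sum_(e <- correlation_phases phasesF h) phase z e = 0.
Proof.
move=> zE h; do 12?[case: h => [|h]] => // _;
  rewrite unlock /=; ring: zE.
Qed.

(** * Periods as an invariant of equivalence *)

Section Periods.
Variable G : finZmodType.
Implicit Types A B : {set G}.

(** In a finite group the inclusion A + h in A is already an equality. *)
Definition periodic A := exists2 h : G, h != 0 & {in A, forall x, x + h \in A}.

(** If s maps A onto B and h is a period of B, then s^-1(h) is a period of A. *)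
Lemma periodic_automorphic A B :
  automorphic_image A B -> periodic B -> periodic A.
Proof.
case/exists_inP=> s; rewrite inE => /andP[_ /morphicP sM] /eqP-> [h hn0 hP].
have sD x y : s (x + y) = s x + s y by apply: sM; rewrite inE.
have shK : s (s^-1 h)%g = h by rewrite permKV.
exists (s^-1 h)%g => [|x xA].
  apply: contraNneq hn0 => sh0; rewrite -shK sh0.
  by apply/eqP/(addrI (s 0)); rewrite -sD !addr0.
have /hP/imsetP[y yA] : s x \in [set s x | x in A] by apply: imset_f.
by rewrite -{1}shK -sD => /perm_inj->.
Qed.

Lemma periodic_translate A B : translate A B -> periodic B -> periodic A.
Proof.
case/existsP=> a /eqP-> [h hn0 hP]; exists h => // x xA.
have /hP/imsetP[y yA] : x + a \in [set x + a | x in A] by apply: imset_f.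
by rewrite addrAC => /addIr->.
Qed.

(** Equivalence is the reachability relation of the elementary steps, so the
    period is pulled back along a path, one step at a time. *)
Lemma periodic_equivalent A B : equivalent A B -> periodic B -> periodic A.
Proof.
case/connectP=> p; elim: p A => [|C p IHp] A /= => [_ -> //|].
case/andP=> /orP AC pP eqB perB.
have {IHp perB pP eqB} := IHp C pP eqB perB.
by case: AC; [apply: periodic_automorphic | apply: periodic_translate].
Qed.

End Periods.

Theorem proposition4p16 (R : realType) :
  let E : {set 'Z_12} := [set 0; 1; 2; 3; 4; 5; 6; 7; 8] in
  let F : {set 'Z_12} := [set 0; 1; 2; 4; 5; 6; 8; 9; 10] in
  [/\ #|E| = 9%N /\ #|F| = 9%N,
      extreme_set R E,
      extreme_set R F
    & ~ equivalent E F].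
Proof.
move=> E F.
have memE (x : 'Z_12) : (x \in E) = (x < 9)%N.
  by rewrite !inE; case: x; do 12?[case=> [|]].
have memF (x : 'Z_12) : (x \in F) = (x %% 4 < 3)%N.
  by rewrite !inE; case: x; do 12?[case=> [|]].
have [z zE] := exists_root24 R.
have E0 : E != set0 by apply/set0Pn; exists 0; rewrite memE.
have F0 : F != set0 by apply/set0Pn; exists 0; rewrite memF.
split.
- split; rewrite -sum1_card big_mkcond /=.
    by under eq_bigr do rewrite memE; rewrite !big_ord_recl big_ord0.
  by under eq_bigr do rewrite memF; rewrite !big_ord_recl big_ord0.
- apply: (root_measure_extreme zE E0 _ (correlations_phasesE zE)) => x.
  by rewrite memE; case: x; do 12?[case=> [|]].
- apply: (root_measure_extreme zE F0 _ (correlations_phasesF zE)) => x.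
  by rewrite memF; case: x; do 12?[case=> [|]].
have perF : periodic F.
  by exists 4 => // x; rewrite !memF; case: x; do 12?[case=> [|]].
(* If h is a period of E, then 0 + h = h is in E, so h <= 8; then 9 - h is in E
   as soon as h != 0, and so is (9 - h) + h = 9, a contradiction. *)
move=> /periodic_equivalent/(_ perF)[h hn0 hP].
have := hP 0; rewrite add0r !memE => /(_ isT) h_lt9.
have := hP (9 - h); rewrite subrK !memE => hP9.
by suff: false by []; apply: hP9; case: h hn0 h_lt9 {hP}; do 12?[case=> [|]].
Qed.
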